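(* For every $n\ge 1$ and every Boolean function $f\colon\{-1,1\}^n\to\{-1,1\}$, $$\mathbb{H}(\hat f^2)\;\le\; 2\cdot \mathsf{aUC}(f),$$ where $\mathbb{H}(\hat f^2)$ is the Fourier entropy of $f$ and $\mathsf{aUC}(f)$ is the average unambiguous certificate complexity of $f$.
   Context: All logarithms are base 2. For $g\colon\{-1,1\}^n\to\mathbb{R}$ and $S\subseteq[n]$, $\hat g(S)=\mathbb{E}_x[g(x)\prod_{i\in S}x_i]$ with $x$ uniform in $\{-1,1\}^n$. For Boolean $f\colon\{-1,1\}^n\to\{-1,1\}$ we have $\sum_S\hat f(S)^2=1$, and the Fourier entropy is $\mathbb{H}(\hat f^2)=\sum_{S\subseteq[n]}\hat f(S)^2\log\frac{1}{\hat f(S)^2}$ (with $0\log\frac10=0$). A subcube of $\{-1,1\}^n$ is a set $C=\{x: x_i=\tau(i)\text{ whenever }\tau(i)\ne *\}$ for some partial assignment $\tau\colon[n]\to\{-1,1,*\}$; its co-dimension is $|\{i:\tau(i)\neq *\}|$. An unambiguous certificate for $f$ is a collection $\mathcal{U}=\{C_1,\dots,C_m\}$ of pairwise disjoint subcubes covering $\{-1,1\}^n$ such that $f$ is constant on each $C_i$. For $x\in\{-1,1\}^n$, $\mathsf{UC}(\mathcal{U},x)$ is the co-dimension of the unique $C_i\in\mathcal U$ containing $x$. Define $\mathsf{aUC}(f,\mathcal{U})=\mathbb{E}_x[\mathsf{UC}(\mathcal{U},x)]$ ($x$ uniform) and $\mathsf{aUC}(f)=\min_{\mathcal{U}}\mathsf{aUC}(f,\mathcal{U})$,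 the minimum being over all unambiguous certificates for $f$. *)

(* Defs.v *)
From mathcomp Require Import all_boot all_order all_algebra.
From mathcomp Require Import reals exp.

Set Implicit Arguments.
Unset Strict Implicit.
Unset Printing Implicit Defensive.

Import Order.TTheory GRing.Theory Num.Theory.
Local Open Scope ring_scope.

(* The two-point set {-1,1} is encoded by bool through pm: false stands for 1
   and true for -1. *)
Definition pm (R : realType) (b : bool) : R := (-1) ^+ b.

Notation cube n := {ffun 'I_n -> bool}.

Section Fourier.
Variables (R : realType) (n : nat).

Definition log2 (a : R) : R := ln a / ln 2.

Definition expect (g : cube n -> R) : R := (\sum_x g x) / #|cube n|%:R.

Definition fourier (g : cube n -> R) (S : {set 'I_n}) : R :=
  expect (fun x => g x * \prod_(i in S) pm R (x i)).

(* When the coefficient is 0 the summand is 0, by the product with 0. *)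
Definition fourier_entropy (f : cube n -> bool) : R :=
  let fhat := fourier (fun x => pm R (f x)) in
  \sum_(S : {set 'I_n}) fhat S ^+ 2 * log2 (1 / fhat S ^+ 2).

End Fourier.

(* None is the star. *)
Notation passign n := {ffun 'I_n -> option bool}.

Section Certificates.
Variable n : nat.

Definition subcube (tau : passign n) : {set cube n} :=
  [set x : cube n | [forall i, (tau i != None) ==> (tau i == Some (x i))]].

Definition codim (tau : passign n) : nat := #|[set i | tau i != None]|.

(* By this lemma, a collection of subcubes is the same thing as a set of
   partial assignments. *)
Lemma subcube_inj : injective subcube.
Proof.
have fixedE (t u : passign n) i b : subcube t = subcube u ->
    t i = Some b -> u i = Some b.
  move=> e ti.
  pose x : cube n := [ffun j => if j == i then ~~ b else odflt false (u j)].
  pose y : cube n := [ffun j => odflt false (u j)].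
  have yu : y \in subcube u.
    by rewrite inE; apply/forallP => j; rewrite ffunE; case: (u j) => //= c.
  have yi : y i = b.
    move: yu; rewrite -e inE => /forallP/(_ i).
    by rewrite ti /= => /eqP[].
  case ui: (u i) => [c|]; first by rewrite -yi ffunE ui.
  have : x \in subcube u.
    rewrite inE; apply/forallP => j; rewrite ffunE.
    by case: (eqVneq j i) => [->|_]; [rewrite ui|case: (u j) => //= c].
  rewrite -e inE => /forallP/(_ i); rewrite ti ffunE eqxx /=.
  by case: b {ti yi x}.
move=> t u e; apply/ffunP => i.
case ti: (t i) => [b|]; first by rewrite (fixedE _ _ _ _ e ti).
by case ui: (u i) => [b|] //; rewrite (fixedE _ _ _ _ (esym e) ui) in ti.
Qed.

Definition unambiguous_certificate (f : cube n -> bool) (U : {set passign n}) :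
    bool :=
  [&& [forall s in U, forall t in U,
         (s != t) ==> [disjoint subcube s & subcube t]],
      \bigcup_(t in U) subcube t == [set: cube n]
    & [forall t in U, forall x in subcube t, forall y in subcube t,
         f x == f y]].

Definition UC (U : {set passign n}) (x : cube n) : nat :=
  if [pick t in U | x \in subcube t] is Some t then codim t else 0%N.

Lemma UC_eq (f : cube n -> bool) (U : {set passign n}) (t : passign n)
    (x : cube n) :
  unambiguous_certificate f U -> t \in U -> x \in subcube t ->
  UC U x = codim t.
Proof.
case/and3P=> dU _ _ tU xt; rewrite /UC.
case: pickP => [s /andP[sU xs]|/(_ t)]; last by rewrite tU xt.
case: (eqVneq s t) => [-> //|st].
move/forall_inP/(_ s sU)/forall_inP/(_ t tU)/implyP/(_ st): dU.
by move/pred0P/(_ x); rewrite /= xs xt.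
Qed.

Definition point_assign (x : cube n) : passign n := [ffun i => Some (x i)].

Definition point_certificate : {set passign n} :=
  [set point_assign x | x : cube n].

Lemma point_certificateP (f : cube n -> bool) :
  unambiguous_certificate f point_certificate.
Proof.
have subE (x y : cube n) :
    (y \in subcube (point_assign x)) = (y == x).
  rewrite inE; apply/forallP/eqP => [h|-> i]; last by rewrite !ffunE eqxx.
  by apply/ffunP => i; have := h i; rewrite !ffunE /= => /eqP[].
apply/and3P; split.
- apply/forall_inP => s /imsetP[x _ ->]; apply/forall_inP => t /imsetP[y _ ->].
  apply/implyP => xy; apply/pred0P => z /=; rewrite !subE.
  by apply/negP => /andP[/eqP zx /eqP zy]; rewrite -zx -zy eqxx in xy.
- apply/eqP/setP => x; rewrite in_setT; apply/bigcupP.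
  by exists (point_assign x); [apply: imset_f | rewrite subE].
- apply/forall_inP => t /imsetP[x _ ->].
  by apply/forall_inP => y; rewrite subE => /eqP ->;
    apply/forall_inP => z; rewrite subE => /eqP ->.
Qed.

End Certificates.

Section AverageUC.
Variables (R : realType) (n : nat).

Definition aUC_of (U : {set passign n}) : R := expect (fun x => (UC U x)%:R).

Definition aUC (f : cube n -> bool) : R :=
  aUC_of [arg min_(U < point_certificate n | unambiguous_certificate f U)
            aUC_of U]%O.

Lemma aUC_attained (f : cube n -> bool) :
  exists2 U, unambiguous_certificate f U & aUC f = aUC_of U.
Proof.
rewrite /aUC; case: arg_minP => [|U fU _]; first exact: point_certificateP.
by exists U.
Qed.

Lemma aUC_le (f : cube n -> bool) (U : {set passign n}) :
  unambiguous_certificate f U -> aUC f <= aUC_of U.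
Proof.
rewrite /aUC; case: arg_minP => [|V _ minV fU]; first exact: point_certificateP.
exact: minV.
Qed.

End AverageUC.

(* Main.v *)
(* Write h for the Fourier coefficients of f, c z for the codimension of the
   cube of U containing z, chi S for the characters, and put
   a z S = f z * chi S z * h S and
   l z S = - c z ln 2 - ln |h S|.  The a z S add up to 2 ^ n, and the sum of
   a z S * l z S is 2 ^ n (ln 2) (H / 2 - aUC), so it has to be shown to be
   nonpositive.  Two facts about a are used.
   (1) Grouping the points z by cubes, the sum of a z S * expR (l z S), taken
   with absolute values, is at most 2 ^ n, because the Fourier transform of
   the indicator of a cube has l1-norm 1.
   (2) The sum of a z S * psi (l z S) is nonnegative for every conditionally
   negative definite psi, by Plancherel.
   For psi u = |u| - 1 + exp (- |u|) we have |1 + l + psi l| <= exp l, hence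
   sum a l = sum a (1 + l + psi l) - sum a - sum a psi <= 2^n - 2^n - 0.
   This is a real-variable form of complex interpolation between the l2-norm
   and the l1-norm of the Fourier transform, differentiated at the l2 end. *)
Require Import Defs.
From mathcomp Require Import all_boot all_order all_algebra.
From mathcomp Require Import reals exp.
From mathcomp Require Import sequences derive normedtype.
From mathcomp Require Import ring lra.
Import Order.TTheory GRing.Theory Num.Theory numFieldNormedType.Exports.
Local Open Scope ring_scope.
Set Implicit Arguments.
Unset Strict Implicit.
Unset Printing Implicit Defensive.

(** * Scalar inequalities for the exponential *)

(** This is tanh (d / 2) <= d / 2 with the denominators cleared; the derivative of the difference is
    nonnegative because 1 + x <= exp x. *)
Lemma tanh_half_le (R : realType) (d : R) :
  0 <= d -> 2 * (1 - expR (- d)) <= d * (1 + expR (- d)).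
Proof.
move=> d0.
pose g (x : R) := x * (1 + expR (- x)) - 2 * (1 - expR (- x)).
have gd (x : R) : is_derive x 1 g (1 - (1 + x) * expR (- x)).
  by apply: is_derive_eq; rewrite /GRing.scale /=; ring.
suff : g 0 <= g d by rewrite /g oppr0 expR0; lra.
apply: (@ger0_derive1_ndecr _ g 0 d) => //.
- move=> x _; rewrite derive1E derive_val expRN subr_ge0 ler_pdivrMr ?expR_gt0//.
  by rewrite mul1r expR_ge1Dx.
- apply: derivable_within_continuous => x _; exact: ex_derive.
Qed.

Lemma sinh_ge (R : realType) (u : R) : 0 <= u -> 2 * u + expR (- u) <= expR u.
Proof.
move=> u0.
pose g (x : R) := expR x - expR (- x) - 2 * x.
have gd (x : R) : is_derive x 1 g (expR x + expR (- x) - 2).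
  by apply: is_derive_eq; rewrite /GRing.scale /=; ring.
suff : g 0 <= g u by rewrite /g oppr0 expR0; lra.
apply: (@ger0_derive1_ndecr _ g 0 u) => //.
- move=> x _; rewrite derive1E derive_val.
  by have := expR_ge1Dx x; have := expR_ge1Dx (- x); lra.
- by apply: derivable_within_continuous => x _; exact: ex_derive.
Qed.

Definition psi (R : realType) (u : R) : R := `|u| - 1 + expR (- `|u|).

(** For u < 0 equality holds, which dictates [psi] on that side; evenness then fixes the other side,
    where sinh u >= u is enough. *)
Lemma psi_window (R : realType) (u : R) : `|1 + u + psi u| <= expR u.
Proof.
rewrite /psi; have [u0|u0] := leP 0 u.
  have h1 := sinh_ge u0; have h2 := expR_gt0 (- u); rewrite (ger0_norm u0).
  have -> : 1 + u + (u - 1 + expR (- u)) = 2 * u + expR (- u) by ring.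
  by rewrite ger0_norm ?addr_ge0 ?mulr_ge0 ?expR_ge0.
rewrite (ltr0_norm u0).
have -> : 1 + u + (- u - 1 + expR (- - u)) = expR u by rewrite opprK; ring.
by rewrite ger0_norm ?expR_ge0.
Qed.

(** * Conditional negative definiteness of [psi] *)

Section ConditionallyNegative.
Variables (R : realType) (I : eqType) (x v : I -> R).

(* With M(r) = \sum_(i <- s) v i * exp (- max(x i - r, 0)), for t above all the
   x i, Q s t is the integral of M ^ 2 over ]-oo, t] and D s t that of
   M(r) * exp (r - t); form_ge0 is Cauchy-Schwarz, and Q s t is independent
   of t when the v i add up to 0. *)
Let V (s : seq I) := \sum_(i <- s) v i.
Let D (s : seq I) (t : R) := \sum_(i <- s) v i * (1 - expR (x i - t) / 2).
Let Q (s : seq I) (t : R) := \sum_(i <- s) \sum_(j <- s)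
  v i * v j * (1 + t - (x i + x j + 1 + psi (x i - x j)) / 2).

Let D_advance s t d :
  D s (t + d) = (1 - expR (- d)) * V s + expR (- d) * D s t.
Proof.
rewrite /D /V !big_distrr -big_split; apply: eq_bigr => i _ /=.
have -> : x i - (t + d) = x i - t + - d by ring.
by rewrite expRD; field.
Qed.

Let Q_advance s t d : Q s (t + d) = Q s t + d * V s ^+ 2.
Proof.
rewrite expr2 /V big_distrl big_distrr /Q -big_split; apply: eq_bigr => i _ /=.
rewrite big_distrr big_distrr -big_split; apply: eq_bigr => j _ /=; ring.
Qed.

Let form_advance s t d : 0 <= d ->
  2 * D s t ^+ 2 <= Q s t -> 2 * D s (t + d) ^+ 2 <= Q s (t + d).
Proof.
move=> d0; rewrite D_advance Q_advance.
have := tanh_half_le d0; have := expR_gt0 (- d).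
have : expR (- d) <= 1 by rewrite expR_le1 oppr_le0.
move: (expR _) (D s t) (V s) (Q s t) => q y z w q1 q0 h yw.
(* Multiplying by [1 + q] allows completing the square in [y]; the remaining coefficient of [z ^+ 2]
   is nonnegative by [tanh_half_le]. *)
suff : 0 <= (1 + q) * (2 * y ^+ 2 + d * z ^+ 2 - 2 * ((1 - q) * z + q * y) ^+ 2).
  by rewrite pmulr_rge0; lra.
have -> : (1 + q) * (2 * y ^+ 2 + d * z ^+ 2 - 2 * ((1 - q) * z + q * y) ^+ 2) =
  2 * (1 - q) * ((1 + q) * y - q * z) ^+ 2 + (d * (1 + q) - 2 * (1 - q)) * z ^+ 2.
  by ring.
by rewrite addr_ge0 // mulr_ge0 ?sqr_ge0 //; lra.
Qed.

Let form_ge0 s t : sorted (fun i j => x j <= x i) s ->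
  (forall i, i \in s -> x i <= t) -> 2 * D s t ^+ 2 <= Q s t.
Proof.
elim: s t => [|a s IH] t.
  by move=> _ _; rewrite /D /Q !big_nil expr0n mulr0.
rewrite /= => sa st.
have sx i : i \in s -> x i <= x a.
  move: sa; rewrite path_sortedE; last by move=> i1 i2 i3 h1 h2; apply: le_trans h2 h1.
  by case/andP => /allP/(_ i).
(* It suffices to treat [t = x a], the largest point. There, adding [a] to the list raises [Q] and
   [2 * D ^+ 2] by the same amount, [v a ^+ 2 / 2 + 2 * v a * D s (x a)]. *)
have -> : t = x a + (t - x a) by rewrite addrC subrK.
apply: form_advance; first by rewrite subr_ge0 st // mem_head.
have {IH} := IH (x a) (path_sorted sa) sx.
have psi0 : psi (x a - x a) = 0 by rewrite subrr /psi normr0 oppr0 expR0; ring.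
have -> : D (a :: s) (x a) = v a / 2 + D s (x a).
  by rewrite /D big_cons subrr expR0; congr (_ + _); field.
suff -> : Q (a :: s) (x a) = v a ^+ 2 / 2 + 2 * v a * D s (x a) + Q s (x a).
  by set y := D _ _; set z := Q _ _; lra.
have cross j : j \in s ->
    1 + x a - (x a + x j + 1 + psi (x a - x j)) / 2 = 1 - expR (x j - x a) / 2.
  by move=> /sx ja; rewrite /psi ger0_norm ?subr_ge0 // opprB; field.
rewrite /Q big_cons big_cons psi0.
under [X in _ + X = _]eq_bigr => i _ do rewrite big_cons.
rewrite big_split /= !addrA; congr (_ + _).
rewrite -addrA; congr (_ + _); first by field.
rewrite -big_split /D big_distrr; apply: eq_big_seq => j js /=.
have -> : psi (x j - x a) = psi (x a - x j) by rewrite /psi distrC.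
by rewrite (addrC (x j)) cross //; ring.
Qed.

Lemma psi_cnd (s : seq I) : \sum_(i <- s) v i = 0 ->
  \sum_(i <- s) \sum_(j <- s) v i * v j * psi (x i - x j) <= 0.
Proof.
move=> v0.
pose le i j := x j <= x i.
pose s' := sort le s.
have ss' : perm_eq s' s by rewrite perm_sort.
have lts : exists t, forall i, i \in s' -> x i <= t.
  elim: {v0 ss'} s' => [|a r [t tr]]; first by exists 0.
  exists (Num.max (x a) t) => i; rewrite inE le_max => /predU1P[->|/tr ->].
    by rewrite lexx.
  by rewrite orbT.
have [t ts] := lts.
have srt : sorted le s' by apply: sort_sorted => i j; exact: le_total.
have : 0 <= Q s' t.
  by apply: le_trans (form_ge0 srt ts); rewrite mulr_ge0 ?sqr_ge0.
have -> : Q s' t = Q s t.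
  rewrite /Q (perm_big _ ss') /=; apply: eq_bigr => i _; exact: perm_big.
suff -> : Q s t =
    - (\sum_(i <- s) \sum_(j <- s) v i * v j * psi (x i - x j)) / 2 by lra.
(* Apart from [psi], the kernel of [Q] is a function of [i] plus a function of [j], so its
   contribution has a factor [V s = 0]. *)
pose A := \sum_(i <- s) v i * (1 / 2 + t - x i / 2).
pose B := \sum_(i <- s) v i * (- x i / 2).
rewrite /Q.
transitivity (A * V s + V s * B -
    (\sum_(i <- s) \sum_(j <- s) v i * v j * psi (x i - x j)) / 2); last first.
  by rewrite /V v0; ring.
rewrite /A /B /V !big_distrl -big_split /= -sumrB; apply: eq_bigr => i _ /=.
by rewrite !big_distrr /= mulr_suml -big_split /= -sumrB; apply: eq_bigr => j _ /=; field.
Qed.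
End ConditionallyNegative.

(** * Fourier analysis on the cube and on subcubes *)

Section FourierInversion.
Variables (R : realType) (n : nat).
Implicit Types (S : {set 'I_n}) (x z : cube n).

Definition chi S z : R := \prod_(i in S) pm R (z i).

Definition flip (i : 'I_n) z : cube n :=
  [ffun j => if j == i then ~~ z j else z j].

Lemma flipK i : involutive (flip i).
Proof.
by move=> z; apply/ffunP => j; rewrite !ffunE; case: eqP => // _; rewrite negbK.
Qed.

Lemma pm_sqr b : pm R b * pm R b = 1.
Proof. by rewrite /pm -expr2 sqrr_sign. Qed.

Lemma norm_pm b : `|pm R b| = 1.
Proof. by rewrite /pm normr_sign. Qed.

Lemma chi_flip S i z : i \in S -> chi S (flip i z) = - chi S z.
Proof.
move=> iS; rewrite /chi (bigD1 i) //= [in RHS](bigD1 i) //= -mulNr.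
congr (_ * _); first by rewrite ffunE eqxx /pm signrN.
by apply: eq_bigr => j /andP[_ /negPf ji]; rewrite ffunE ji.
Qed.

Lemma chi_flip_notin S i z : i \notin S -> chi S (flip i z) = chi S z.
Proof.
move=> iS; apply: eq_bigr => j jS; rewrite ffunE ifN //.
by apply: contraNneq iS => <-.
Qed.

Lemma norm_chi S z : `|chi S z| = 1.
Proof. by rewrite /chi normr_prod big1 // => i _; rewrite norm_pm. Qed.

(** The sum over [S] expands a product over coordinates of 1 + x_i z_i, which has a zero factor
    wherever the points differ. *)
Lemma chi_kernel x z :
  \sum_S chi S x * chi S z = #|cube n|%:R * (x == z)%:R.
Proof.
transitivity (\prod_i (pm R (x i) * pm R (z i) + 1)).
  rewrite bigA_distr /=; apply: eq_bigr => S _.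
  by rewrite -big_split big_mkcond.
have [->|xz] := eqVneq x z.
  rewrite mulr1 (eq_bigr (fun=> 2%:R)) => [|i _]; last by rewrite pm_sqr.
  by rewrite prodr_const card_ffun card_bool card_ord natrX.
have /existsP[i xzi] : [exists i, x i != z i].
  apply: contraNT xz; rewrite negb_exists => /forallP e.
  by apply/eqP/ffunP => i; have := e i; rewrite negbK => /eqP.
rewrite mulr0 (bigD1 i) //= (_ : _ + 1 = 0) ?mul0r //.
by case: (x i) (z i) xzi => [] [] //= _; rewrite /pm expr0 expr1; ring.
Qed.

Lemma sum_antisym (A : {set cube n}) i (F : cube n -> R) :
  (forall z, (flip i z \in A) = (z \in A)) ->
  (forall z, F (flip i z) = - F z) -> \sum_(z in A) F z = 0.
Proof.
move=> Ai Fi; apply/eqP.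
suff : \sum_(z in A) F z = - \sum_(z in A) F z by move=> e; apply/eqP; lra.
rewrite [LHS](reindex_inj (inv_inj (flipK i))) -sumrN /=.
by apply: eq_big => z; [exact: Ai|rewrite Fi].
Qed.

Lemma chi_orthogonal S T : S != T -> \sum_z chi S z * chi T z = 0.
Proof.
move=> ST.
have /existsP[i STi] : [exists i, (i \in S) != (i \in T)].
  apply: contraNT ST; rewrite negb_exists => /forallP e.
  by apply/eqP/setP => i; have := e i; rewrite negbK => /eqP.
rewrite (eq_bigl (fun z => z \in [set: cube n])) => [|z]; last by rewrite inE.
apply: (@sum_antisym _ i) => z; first by rewrite !inE.
case: (boolP (i \in S)) (boolP (i \in T)) STi => iS [] iT //= _.
  by rewrite chi_flip // chi_flip_notin // mulNr.
by rewrite chi_flip_notin // chi_flip // mulrN.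
Qed.

Lemma card_cube_gt0 : 0 < #|cube n|%:R :> R.
Proof. by rewrite ltr0n card_ffun card_bool expn_gt0. Qed.

Lemma fourier_sum (g : cube n -> R) S :
  \sum_z g z * chi S z = #|cube n|%:R * fourier g S.
Proof.
by rewrite /fourier /expect mulrC divfK // gt_eqF // card_cube_gt0.
Qed.

Lemma fourier_inversion (g : cube n -> R) z :
  \sum_S fourier g S * chi S z = g z.
Proof.
have N0 := card_cube_gt0.
apply: (mulfI (lt0r_neq0 N0)); rewrite mulr_sumr.
under eq_bigr => S _ do rewrite mulrA -fourier_sum mulr_suml.
rewrite exchange_big /= (bigD1 z) //= [X in _ + X]big1 => [|x xz].
  under eq_bigr => S _ do rewrite -mulrA.
  by rewrite -mulr_sumr chi_kernel eqxx mulr1 addr0 mulrC.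
under eq_bigr => S _ do rewrite -mulrA.
by rewrite -mulr_sumr chi_kernel (negPf xz) !mulr0.
Qed.

Lemma card_subcube (t : passign n) :
  #|subcube t|%:R = #|cube n|%:R / 2 ^+ codim t :> R.
Proof.
pose F i b : R := ((t i != None) ==> (t i == Some b))%:R.
transitivity (\sum_(z : cube n) \prod_i F i (z i)).
  rewrite -sum1_card natr_sum big_mkcond /=; apply: eq_bigr => z _.
  rewrite inE; case: forallP => [h|/forallP].
    by rewrite big1 // => i _; rewrite /F h.
  rewrite negb_forall => /existsP[i hi].
  by rewrite (bigD1 i) //= /F (negPf hi) mul0r.
rewrite -bigA_distr_bigA /=.
rewrite (eq_bigr (fun i =>
  2 * (if i \in [set i | t i != None] then 2^-1 else 1))); last first.
  by move=> i _; rewrite big_bool /F inE; case: (t i) => [[]|] //=; field.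
rewrite big_split /= prodr_const card_ffun card_bool card_ord natrX.
by rewrite -big_mkcond prodr_const /= exprVn.
Qed.

(** If [S] contains a free coordinate, flipping it preserves the subcube and negates the character;
    otherwise the bound is the size of the subcube. *)
Lemma sum_chi_subcube (t : passign n) S :
  `|\sum_(z in subcube t) chi S z| <=
  if S \in powerset [set i | t i != None] then #|cube n|%:R / 2 ^+ codim t else 0.
Proof.
rewrite inE; case: (boolP (S \subset _)) => [_|/subsetPn[i iS ti]].
  rewrite -card_subcube -sum1_card natr_sum; apply: le_trans (ler_norm_sum _ _ _) _.
  by apply: ler_sum => z _; rewrite norm_chi.
rewrite (@sum_antisym _ i) ?normr0 // => z; last exact: chi_flip.
rewrite !inE; apply: eq_forallb => j; rewrite ffunE; case: (j =P i) => // ->.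
by move: ti; rewrite inE negbK => /eqP ti; rewrite ti.
Qed.

(** Only the 2 ^ codim sets of fixed coordinates contribute, which exactly offsets the density of
    the subcube. *)
Lemma sum_norm_chi_subcube (t : passign n) :
  \sum_S `|\sum_(z in subcube t) chi S z| <= #|cube n|%:R.
Proof.
apply: le_trans (ler_sum _ (fun S _ => sum_chi_subcube t S)) _.
rewrite -big_mkcond sumr_const card_powerset -/(codim t) -[_ *+ (2 ^ _)]mulr_natr natrX.
by rewrite divfK ?expf_neq0 ?pnatr_eq0.
Qed.

End FourierInversion.

(** * The entropy bound for a fixed certificate *)

Section Certificate.
Variables (R : realType) (n : nat) (f : cube n -> bool) (U : {set passign n}).
Hypothesis fU : unambiguous_certificate f U.

Let N : R := #|cube n|%:R.
Let g z := pm R (f z).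
Let h S := fourier g S.
Let a z S := g z * chi R S z * h S.

Lemma sum_certificate (F : cube n -> R) :
  \sum_z F z = \sum_(t in U) \sum_(z in subcube t) F z.
Proof.
case/and3P: fU => dU cU _.
rewrite (exchange_big_dep predT) //=; apply: eq_bigr => z _.
have : z \in \bigcup_(t in U) subcube t by rewrite (eqP cU) inE.
case/bigcupP => t tU zt; rewrite (big_pred1 t) // => s /=.
apply/idP/eqP => [/andP[sU zs]|->]; last by rewrite tU.
apply/eqP/negPn/negP => st.
move/forall_inP/(_ s sU)/forall_inP/(_ t tU)/implyP/(_ st): dU.
by move/pred0P/(_ z); rewrite /= zs zt.
Qed.

Let sum_a_S z : \sum_S a z S = 1.
Proof.
transitivity (g z * \sum_S fourier g S * chi R S z).
  by rewrite mulr_sumr; apply: eq_bigr => S _; rewrite /a -/(h S); ring.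
by rewrite fourier_inversion pm_sqr.
Qed.

Let sum_a_z S : \sum_z a z S = N * h S ^+ 2.
Proof. by rewrite -mulr_suml fourier_sum -mulrA expr2. Qed.

Let u z : R := - (ln 2 * (UC U z)%:R).
(** At [h S = 0] this takes the default value of [ln], harmlessly: it only enters with a factor
    [h S]. *)
Let y S : R := ln `|h S|.

(* For each [z'] the numbers [g z * (z == z')], indexed by points [z], and
   [- h S * chi S z'], indexed by sets [S], add up to 0 by Fourier inversion;
   summing over [z'] kills the diagonal blocks by orthogonality. *)
Let sum_a_psi_ge0 : 0 <= \sum_z \sum_S a z S * psi (u z - y S).
Proof.
pose I : finType := (cube n + {set 'I_n})%type.
pose pos (i : I) := match i with inl z => u z | inr T => y T end.
pose w z' (i : I) : R :=
  match i with inl z => g z * (z == z')%:R | inr T => - (h T * chi R T z') end.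
have w0 z' : \sum_i w z' i = 0.
  rewrite big_sumType /= sumrN fourier_inversion (bigD1 z') //= eqxx mulr1.
  rewrite big1 => [|z /negPf ->]; last by rewrite mulr0.
  by rewrite addr0 subrr.
(* Orthogonality says nothing about a pair of equal indices; such pairs drop out because [psi]
   vanishes at 0. *)
have psi0 : psi 0 = 0 :> R by rewrite /psi normr0 oppr0 expR0; ring.
have psiN v : psi (- v) = psi v :> R by rewrite /psi normrN.
have : \sum_z' \sum_i \sum_j w z' i * w z' j * psi (pos i - pos j) <= 0.
  by apply: sumr_le0 => z' _; apply: psi_cnd.
rewrite exchange_big /=; under eq_bigr => i _ do rewrite exchange_big /=.
rewrite big_sumType /=.
under eq_bigr => z _ do rewrite big_sumType /=.
under [X in _ + X <= _]eq_bigr => S _ do rewrite big_sumType /=.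
rewrite !big_split /=.
have -> : \sum_z \sum_z0 \sum_z' g z * (z == z')%:R * (g z0 * (z0 == z')%:R) *
    psi (u z - u z0) = 0.
  apply: big1 => z _; apply: big1 => z0 _; apply: big1 => z' _.
  have [->|_] := eqVneq z z'; last by rewrite !mulr0 !mul0r.
  have [->|_] := eqVneq z0 z'; last by rewrite !mulr0 !mul0r.
  by rewrite subrr psi0 mulr0.
have -> : \sum_S \sum_T \sum_z' - (h S * chi R S z') * - (h T * chi R T z') *
    psi (y S - y T) = 0.
  apply: big1 => S _; apply: big1 => T _.
  have [->|ST] := eqVneq S T.
    by apply: big1 => z' _; rewrite subrr psi0 mulr0.
  transitivity (h S * h T * psi (y S - y T) * \sum_z' chi R S z' * chi R T z').
    by rewrite mulr_sumr; apply: eq_bigr => z' _; ring.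
  by rewrite chi_orthogonal // mulr0.
(* The two mixed blocks survive. As [psi] is even, each is minus the desired sum. *)
have E1 z S : \sum_z' g z * (z == z')%:R * - (h S * chi R S z') * psi (u z - y S)
    = - (a z S * psi (u z - y S)).
  rewrite (bigD1 z) //= eqxx big1 => [|z' /negPf]; last first.
    by rewrite eq_sym => ->; rewrite mulr0 !mul0r.
  by rewrite mulr1 /a; ring.
have E2 z S : \sum_z' - (h S * chi R S z') * (g z * (z == z')%:R) * psi (y S - u z)
    = - (a z S * psi (u z - y S)).
  rewrite -E1; apply: eq_bigr => z' _; rewrite -opprB psiN; ring.
under eq_bigr => z _ do under eq_bigr => S _ do rewrite E1.
under [X in _ + (X + _) <= _]eq_bigr => S _ do under eq_bigr => z _ do rewrite E2.
rewrite [X in _ + (X + _)]exchange_big /=.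
under eq_bigr => z _ do rewrite sumrN.
rewrite sumrN; lra.
Qed.

(** On a subcube of [U] both [g] and [u] are constant, so the sum over its points reduces to a
    character sum. By [psi_window] its multiplier is at most 2 ^ (- codim), and
    [sum_norm_chi_subcube] applies. *)
Let sum_a_window :
  `|\sum_z \sum_S a z S * (1 + (u z - y S) + psi (u z - y S))| <= N.
Proof.
rewrite sum_certificate; apply: le_trans (ler_norm_sum _ _ _) _.
(* The subcubes partition the cube, so their sizes add up to [N]; the bound can then be proved one
   subcube at a time. *)
have -> : N = \sum_(t in U) N / 2 ^+ codim t.
  transitivity (\sum_(z : cube n) (1 : R)); first by rewrite sumr_const.
  rewrite sum_certificate; apply: eq_bigr => t _.
  by rewrite sumr_const card_subcube.
apply: ler_sum => t tU; rewrite exchange_big /=.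
have c0 : 0 < 2 ^+ codim t :> R by rewrite exprn_gt0.
apply: le_trans (ler_norm_sum _ _ _) _.
have := sum_norm_chi_subcube R t.
rewrite -/N -(ler_pM2r (_ : 0 < (2 ^+ codim t)^-1)) ?invr_gt0 //.
apply: le_trans; rewrite mulr_suml; apply: ler_sum => S _.
have [z0 z0t|t0] := pickP (mem (subcube t)); last first.
  by rewrite !big_pred0 // normr0 mul0r.
have gt z : z \in subcube t -> g z = g z0.
  case/and3P: fU => _ _ /forall_inP/(_ t tU)/forall_inP hc zt.
  by rewrite /g (eqP (forall_inP (hc z zt) z0 z0t)).
pose l := - (ln 2 * (codim t)%:R) - y S.
have -> : \sum_(z in subcube t) a z S * (1 + (u z - y S) + psi (u z - y S)) =
    (\sum_(z in subcube t) chi R S z) * (g z0 * (h S * (1 + l + psi l))).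
  rewrite mulr_suml; apply: eq_bigr => z zt.
  by rewrite /a gt // /u (UC_eq fU tU zt) -/l; ring.
rewrite normrM ler_wpM2l // normrM norm_pm mul1r normrM.
(* Cancelling [h S] against exp (- [y S]) requires [h S] to be nonzero. *)
have [->|hS] := eqVneq (h S) 0; first by rewrite normr0 mul0r invr_ge0 ltW.
have nh0 : 0 < `|h S| by rewrite normr_gt0.
apply: le_trans (ler_wpM2l (normr_ge0 _) (psi_window l)) _.
rewrite /l /y expRB lnK ?posrE // expRN mulrC expRM_natr lnK ?posrE //.
by rewrite divfK // gt_eqF.
Qed.

Lemma entropy_le_aUC_of : fourier_entropy R f <= 2 * aUC_of R U.
Proof.
have N0 : 0 < N := card_cube_gt0 R n.
have ln2 : 0 < ln 2 :> R by rewrite ln_gt0 // ltr1n.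
have total : \sum_z \sum_S a z S = N.
  by under eq_bigr do rewrite sum_a_S; rewrite sumr_const.
have main : \sum_z \sum_S a z S * (u z - y S) <= 0.
  have := le_trans (ler_norm _) sum_a_window.
  rewrite (_ : \sum_z _ = \sum_z \sum_S a z S + \sum_z \sum_S a z S * (u z - y S)
    + \sum_z \sum_S a z S * psi (u z - y S)).
    by rewrite total; have := sum_a_psi_ge0; lra.
  rewrite -!big_split; apply: eq_bigr => z _ /=.
  by rewrite -!big_split; apply: eq_bigr => S _ /=; ring.
have entropyE : fourier_entropy R f = - 2 / ln 2 * \sum_S h S ^+ 2 * y S.
  rewrite /fourier_entropy mulr_sumr; apply: eq_bigr => S _.
  rewrite -/g -/(h S) /log2 div1r /y.
  have [->|hS] := eqVneq (h S) 0; first by rewrite expr0n /= !mul0r mulr0.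
  have hS0 : 0 < `|h S| by rewrite normr_gt0.
  rewrite lnV ?posrE ?exprn_even_gt0 // -real_normK ?num_real // lnXn //.
  by rewrite mulr2n; field; rewrite gt_eqF.
(* The [u] part is summed over [S] first, with row sums 1; the [y] part over [z] first, with column
   sums [N * h S ^+ 2]. *)
have sumE : \sum_z \sum_S a z S * (u z - y S) =
    N * (- ln 2 * aUC_of R U - \sum_S h S ^+ 2 * y S).
  transitivity (\sum_z u z - \sum_S N * h S ^+ 2 * y S).
    under [X in _ = _ - X]eq_bigr => S _ do rewrite -sum_a_z mulr_suml.
    rewrite [X in _ = _ - X]exchange_big -sumrB /=; apply: eq_bigr => z _.
    under eq_bigr => S _ do rewrite mulrBr.
    by rewrite sumrB -mulr_suml sum_a_S mul1r.
  rewrite mulrBr mulr_sumr; congr (_ - _); last first.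
    by apply: eq_bigr => S _; rewrite -mulrA.
  rewrite /u /aUC_of /expect -/N sumrN -mulr_sumr; field; exact: lt0r_neq0.
move: main; rewrite sumE pmulr_rle0 // entropyE => main.
rewrite mulrAC ler_pdivrMr //; lra.
Qed.

End Certificate.

Theorem theorem1p5 (R : realType) (n : nat) (n_ge1 : (1 <= n)%N)
    (f : cube n -> bool) :
  fourier_entropy R f <= 2 * aUC R f.
Proof. by have [U fU ->] := aUC_attained R f; exact: entropy_le_aUC_of. Qed.
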